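(* For any group $G$, the graph $\mathcal{B}(G)$ has the following properties: (1) $\mathrm{girth}(\mathcal{B}(G))=0$ and $\mathrm{diam}(\mathcal{B}(G))=1$ or $\infty$. (2) $\nu(\mathcal{B}(G))=|L_2(G)|$. (3) $\omega(\mathcal{B}(G))=2$.
   Context: For a group $G$, let $L(G)$ be the set of all subgroups of $G$. The graph $\mathcal{B}(G)$ is the simple undirected bipartite graph with vertex set the disjoint union $V(\mathcal{B}(G)) = (G\times G) \sqcup L(G)$, in which $(a,b)\in G\times G$ and $H \in L(G)$ are adjacent if and only if $H = \langle a,b\rangle$, and there are no other edges. $L_2(G)=\{H\in L(G): H \text{ is generated by 1 or 2 elements}\}$. For a graph $\Gamma$: $\mathrm{girth}(\Gamma)$ is the length of a smallest cycle, with the convention that it is $0$ if $\Gamma$ has no cycle; $\mathrm{diam}(\Gamma)$ is the maximum distance between two vertices, with the convention that it is $\infty$ if $\Gamma$ is disconnected; $\nu(\Gamma)$ (matching number) is the maximum number of edges in a matching, i.e. in a set of edges no two of which share a vertex; $\omega(\Gamma)$ (clique number) is the maximum number of vertices in a set of pairwise adjacent vertices. *)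

(* Defs.v *)
From HB Require Import structures.
From mathcomp Require Import all_boot.
From mathcomp Require Import boolp classical_sets functions cardinality.
From mathcomp Require Import constructive_ereal.

Set Implicit Arguments.
Unset Strict Implicit.
Unset Printing Implicit Defensive.

Local Open Scope classical_set_scope.
Local Open Scope card_scope.

Definition least (A : set nat) : set nat :=
  [set n | A n /\ forall m, A m -> n <= m].

Definition greatest (A : set nat) : set nat :=
  [set n | A n /\ forall m, A m -> m <= n].

(* The maximum cardinality of a member of the family F is attained and is the
   cardinality of A. This is stated by equipotence and domination, so that it
   also makes sense for infinite cardinals. *)
Definition max_card_eq (V T : Type) (F : set (set V)) (A : set T) : Prop :=
  (exists2 S, F S & S #= A) /\ (forall S, F S -> S #<= A).

(* Simple undirected graphs, possibly infinite. *)
Record sgraph := SGraph {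
  vertex :> eqType;
  adj : rel vertex;
  adj_sym : symmetric adj;
  adj_irr : irreflexive adj }.

Section GraphInvariants.
Variable Gamma : sgraph.

(* A cycle is a cyclic sequence of at least 3 distinct vertices. *)
Definition cycle_lengths : set nat :=
  [set n | exists p : seq Gamma, [/\ ucycle (@adj Gamma) p, 3 <= size p
                                   & size p = n]].

Definition girth : nat := xget 0 (least cycle_lengths).

Definition walk_lengths (u v : Gamma) : set nat :=
  [set n | exists p : seq Gamma, [/\ path (@adj Gamma) u p, last u p = v
                                   & size p = n]].

Definition connected_graph : Prop :=
  forall u v : Gamma, walk_lengths u v !=set0.

(* Only meaningful when some walk joins u to v; the default 0 is never used by
   diam. *)
Definition dist (u v : Gamma) : nat := xget 0 (least (walk_lengths u v)).

Definition distances : set nat := [set n | exists u v : Gamma, dist u v = n].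

(* The value is also +oo for a connected graph with unbounded distances. *)
Definition diam : \bar nat :=
  if pselect connected_graph then xget +oo%E (EFin @` greatest distances)
  else +oo%E.

Definition edges : set (set Gamma) :=
  [set e | exists u v : Gamma, adj u v /\ e = [set u; v]].

Definition is_matching (M : set (set Gamma)) : Prop :=
  M `<=` edges /\ trivIset M id.

Definition is_clique (S : set Gamma) : Prop :=
  forall u v, S u -> S v -> u <> v -> adj u v.

Definition matching_number_eq (T : Type) (A : set T) : Prop :=
  max_card_eq is_matching A.

Definition clique_number_eq (T : Type) (A : set T) : Prop :=
  max_card_eq is_clique A.

End GraphInvariants.

Section GeneratingGraph.
Variable G : groupType.

Definition subgroups : set (set G) := [set H : set G | group_closed [in H]].

Definition gen (X : set G) : set G := smallest subgroups X.

Definition L2 : set (set G) :=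
  [set H | subgroups H /\ ((exists a, H = gen [set a]) \/
                           (exists a b, H = gen [set a; b]))].

Definition B_vertex : eqType := ((G * G) + subgroups)%type.

Definition B_adj : rel B_vertex := fun x y =>
  match x, y with
  | inl (a, b), inr H | inr H, inl (a, b) => `[< val H = gen [set a; b] >]
  | _, _ => false
  end.

Lemma B_adj_sym : symmetric B_adj.
Proof. by move=> [[a b]|H] [[c d]|K]. Qed.

Lemma B_adj_irr : irreflexive B_adj.
Proof. by move=> [[a b]|H]. Qed.

Definition B : sgraph := SGraph B_adj_sym B_adj_irr.

End GeneratingGraph.

Arguments subgroups : clear implicits.
Arguments L2 : clear implicits.

(* Main.v *)
(* An element (a, b) of G * G has exactly one neighbour, namely <a, b>, so B(G)
   is the disjoint union of the stars centred at the subgroups of G. A star has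
   no cycle and at most two vertices of any clique, and a matching contains at
   most one edge of each star, while the stars having an edge are those centred
   at L_2(G). If B(G) is connected there is a single star, so <a, a> = <1, 1> for
   all a; hence G is trivial and B(G) is a single edge. *)
Require Import Defs.
From mathcomp Require Import all_boot.
From mathcomp Require Import boolp classical_sets functions cardinality.
From mathcomp Require Import constructive_ereal.

Local Open Scope classical_set_scope.

Lemma card_le_injP T U (A : set T) (B : set U) (f : T -> U) :
  {in A &, injective f} -> f @` A `<=` B -> (A #<= B)%card.
Proof.
move=> f_inj /subset_card_le; apply: card_le_trans.
by have := inj_card_eq f_inj; rewrite card_eq_le => /andP[].
Qed.

Section Generation.
Context {G : groupType}.

Lemma gen_subgroup (X : set G) : subgroups G (gen X).
Proof.
split; first by apply/mem_set => A [[A1 _] _]; apply/set_mem.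
move=> x y /set_mem gx /set_mem gy; apply/mem_set => A AX.
by apply/set_mem; apply: AX.1.2; apply/mem_set; [exact: gx | exact: gy].
Qed.

Lemma subgroup1 : subgroups G [set 1%g].
Proof.
split; first by apply/mem_set.
by move=> x y /set_mem -> /set_mem ->; apply/mem_set; rewrite /= divg1.
Qed.

(** A single generator is the pair with $a$ repeated, so one shape of generating set suffices. *)
Lemma L2P (H : set G) : L2 G H <-> exists a b, H = gen [set a; b].
Proof.
split=> [[_ [[a ->]|//]]|[a [b ->]]]; first by exists a, a; rewrite setUid.
by split; [exact: gen_subgroup | right; exists a, b].
Qed.

(** The star containing [u], named by the bare set underlying its centre, so that pairs and
    subgroups are compared in one type. *)
Definition star (u : B G) : set G :=
  match u with inl (a, b) => gen [set a; b] | inr H => val H end.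

Definition is_center (u : B G) : bool :=
  match u with inl _ => false | inr _ => true end.

Lemma B_adjP (u v : B G) :
  reflect (is_center u != is_center v /\ star u = star v) (adj u v).
Proof.
case: u v => [[a b]|H] [[c d]|K] /=.
- by apply: (iffP idP) => [|[]].
- by apply: (iffP idP) => [/asboolP ->|[_ /esym/asboolP]].
- by apply: (iffP idP) => [/asboolP|[_ /asboolP]].
- by apply: (iffP idP) => [|[]].
Qed.

Lemma center_inj (u v : B G) :
  is_center u -> is_center v -> star u = star v -> u = v.
Proof. by case: u v => [[a b]|H] [[c d]|K] //= _ _ /val_inj ->. Qed.

(** Both neighbours are centres of the star of [u], and a star has only one centre. *)
Lemma leaf_adj_inj (u v w : B G) :
  ~~ is_center u -> adj u v -> adj u w -> v = w.
Proof.
move=> /negPf uN /B_adjP[uv suv] /B_adjP[uw suw].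
by apply: center_inj; rewrite -?suv //; move: uv uw; rewrite uN; case: is_center;
  case: is_center.
Qed.

Definition center_of (a b : G) : B G :=
  inr (exist _ (gen [set a; b]) (mem_set (gen_subgroup [set a; b]))).

Lemma adj_center_of (a b : G) : @adj (B G) (inl (a, b)) (center_of a b).
Proof. by apply/B_adjP. Qed.

Lemma walk_star (u v : B G) (n : nat) : walk_lengths u v n -> star u = star v.
Proof.
case=> p [+ + _]; elim: p u => [|w p IHp] u /= => [_ -> //|].
by case/andP=> /B_adjP[_ ->] /IHp.
Qed.

(** Of the consecutive vertices [y] and [z] one is a leaf, whose two neighbours on the cycle would
    have to coincide. *)
Lemma B_no_cycle (n : nat) : ~ cycle_lengths (B G) n.
Proof.
case=> -[|x [|y [|z s]]] [] // /andP[] /=.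
case/and3P=> xy yz zs; rewrite !inE !negb_or -!andbA.
case/and5P=> _ xz _ yzN /and3P[yNs _ _] _ _.
case: (boolP (is_center y)) => [yC|yN].
  have zN : ~~ is_center z by have /B_adjP[] := yz; rewrite yC; case: is_center.
  have xN : ~~ is_center x by have /B_adjP[] := xy; rewrite yC; case: is_center.
  have zy : adj z y by rewrite adj_sym.
  (* In a triangle [z] is joined back to the leaf [x]; in a longer cycle its next neighbour [w]
     differs from [y]. *)
  case: s zs yNs => [|w s] /=.
    by rewrite andbT => /B_adjP[]; rewrite (negPf zN) (negPf xN).
  case/andP=> zw _; rewrite inE negb_or => /andP[/eqP yw _].
  by case: yw; apply: (leaf_adj_inj _ _ _ zN).
by move/eqP: xz; case; apply: (leaf_adj_inj _ _ _ yN) => //; rewrite adj_sym.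
Qed.

Lemma girth_B : girth (B G) = 0.
Proof. by rewrite /girth xgetPN // => n [/B_no_cycle]. Qed.

Lemma connected_star (u v : B G) : connected_graph (B G) -> star u = star v.
Proof. by move=> /(_ u v)[n /walk_star]. Qed.

Lemma connected_trivial : connected_graph (B G) -> forall a : G, a = 1%g.
Proof.
move=> conn a.
suff : star (inl (1%g, 1%g)) a.
  (* $\langle 1,1\rangle$ is an intersection of subgroups, one of which is $\{1\}$. *)
  by move=> /(_ [set 1%g]); apply; split; [exact: subgroup1 | move=> x []].
rewrite (connected_star _ (inl (a, a)) conn) => A [_]; apply; by left.
Qed.

(** There is only one star, hence one centre, and only one pair because $G$ is trivial; so distinct
    vertices are of opposite kinds. *)
Lemma connected_adj (u v : B G) :
  connected_graph (B G) -> u <> v -> adj u v.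
Proof.
move=> conn uv; have triv := connected_trivial conn.
have suv := connected_star u v conn; apply/B_adjP; split => //.
apply/negP => /eqP cuv; apply: uv.
case: (boolP (is_center u)) => uC; first by apply: center_inj; rewrite -?cuv.
case: u v uC cuv {suv} => [[a b]|//] [[c d]|//] _ _.
by rewrite (triv a) (triv b) (triv c) (triv d).
Qed.

End Generation.

Lemma distE (Gamma : sgraph) (u v : Gamma) (n : nat) :
  walk_lengths u v n -> (forall m, walk_lengths u v m -> n <= m) ->
  dist u v = n.
Proof.
move=> un min; apply: xget_unique => // m [um minm].
by apply/eqP; rewrite eqn_leq min // minm.
Qed.

Lemma dist_refl (Gamma : sgraph) (u : Gamma) : dist u u = 0.
Proof. by apply: distE => //; exists [::]. Qed.

Lemma dist_adj (Gamma : sgraph) (u v : Gamma) : adj u v -> dist u v = 1.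
Proof.
move=> uv; apply: distE; first by exists [:: v]; rewrite /= uv.
case=> // -[[|x p] [] //= _ E _].
by move: uv; rewrite E adj_irr.
Qed.

Lemma diam_B (G : groupType) : diam (B G) = 1%N%:E \/ diam (B G) = +oo%E.
Proof.
rewrite /diam; case: pselect => [conn|]; [left | by right].
have d1 : greatest (distances (B G)) 1.
  split; first by exists (inl (1%g, 1%g)), (center_of 1%g 1%g);
    exact/dist_adj/adj_center_of.
  move=> _ [u [v <-]]; have [->|/eqP uv] := eqVneq u v; first by rewrite dist_refl.
  by rewrite dist_adj //; exact: connected_adj.
apply: xget_unique; first by exists 1.
move=> _ [n [Dn maxn] <-]; congr EFin.
by apply/eqP; rewrite eqn_leq (d1.2 _ Dn) (maxn _ d1.1).
Qed.

Lemma matching_B (G : groupType) : matching_number_eq (B G) (L2 G).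
Proof.
split.
  (* [e] picks a generating pair for each member of $L_2(G)$; its value $(1,1)$ elsewhere is a mere
     default. *)
  have /choice[e eP] (H : set G) : exists ab : G * G,
      L2 G H -> H = gen [set ab.1; ab.2].
    case: (pselect (L2 G H)) => [/L2P[a [b ->]]|]; first by exists (a, b).
    by exists (1%g, 1%g).
  pose edge H : set (B G) := [set inl (e H); center_of (e H).1 (e H).2].
  have star_edge H u : L2 G H -> edge H u -> star u = H.
    by move=> /eP {2}->; rewrite /edge; case: (e H) => a b [] ->.
  have edgeP H : edge H (inl (e H)) by left.
  exists (edge @` L2 G).
    split=> [_ [H _ <-]|_ _ [H LH <-] [K LK <-] [u [Hu Ku]]].
      exists (inl (e H)), (center_of (e H).1 (e H).2); split=> //.
      by case: (e H) => a b; exact: adj_center_of.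
    by rewrite -(star_edge _ _ LH Hu) (star_edge _ _ LK Ku).
  (* The star of any endpoint recovers [H] from its edge, so distinct subgroups give distinct
     edges. *)
  apply: inj_card_eq => H K /set_mem LH /set_mem LK HK.
  rewrite -(star_edge _ _ LH (edgeP H)); apply: star_edge => //.
  by rewrite -HK; exact: edgeP.
move=> M [Medges Mtriv].
(* Both ends of an edge have the same star, so the choice of end is harmless; the default serves
   only the empty set. *)
pose f (S : set (B G)) : set G := star (xget (inl (1%g, 1%g)) S).
have edgeE a b : f [set inl (a, b); center_of a b] = gen [set a; b].
  by rewrite /f; case: xgetP => [_ -> [] ->|/(_ (inl (a, b)))] //=; case; left.
have MP S : M S -> exists a b, S = [set inl (a, b); center_of a b].
  have cE a b (v : B G) : adj (inl (a, b) : B G) v -> v = center_of a b.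
    by move=> uv; apply: leaf_adj_inj _ uv (adj_center_of a b).
  move=> /Medges[[[a b]|H] [[[c d]|K] [uv ->]]] //.
    by exists a, b; rewrite (cE _ _ _ uv).
  by exists c, d; rewrite setUC (cE c d (inr H)) // adj_sym.
apply: (@card_le_injP _ _ _ _ f) => [S T /set_mem MS /set_mem MT|_ [S MS <-]].
  have [a [b SE]] := MP _ MS; have [c [d TE]] := MP _ MT.
  rewrite {1}SE {1}TE !edgeE => ST.
  (* Edges of the same star meet in its centre, so in a matching they are equal. *)
  apply: Mtriv => //; exists (center_of a b); rewrite SE TE; split; right => //=.
  exact: center_inj.
by have [a [b ->]] := MP _ MS; rewrite edgeE; apply/L2P; exists a, b.
Qed.

Lemma clique_B (G : groupType) : clique_number_eq (B G) `I_2.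
Proof.
(* Adjacent vertices are of opposite kinds, so the kind, read as 0 or 1, embeds a clique into
   [I_2]. *)
have is_center_inj (S : set (B G)) :
    is_clique S -> {in S &, injective (fun u => nat_of_bool (is_center u))}.
  move=> Sc u v /set_mem Su /set_mem Sv; case: (pselect (u = v)) => // uv.
  have /B_adjP[+ _] := Sc _ _ Su Sv uv.
  by case: is_center; case: is_center.
split=> [|S /is_center_inj S_inj]; last first.
  by apply: card_le_injP S_inj _ => _ [u _ <-] /=; case: is_center.
pose u : B G := inl (1%g, 1%g); pose v : B G := center_of 1%g 1%g.
have uvC : is_clique [set u; v].
  move=> _ _ [] -> [] -> // _; [|rewrite adj_sym]; exact: adj_center_of.
exists [set u; v] => //.
(* A pair and its centre realise both kinds, so the bound 2 is attained. *)
have <- : (fun w : B G => nat_of_bool (is_center w)) @` [set u; v] = `I_2.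
  by apply/seteqP; split=> [_ [_ [] -> <-]|[|[|//]] _] //=;
    [exists u; [left|] | exists v; [right|]].
by rewrite card_eq_sym; apply: inj_card_eq; exact: is_center_inj.
Qed.

Theorem theorem2p5 (G : groupType) :
  (girth (B G) = 0 /\ (diam (B G) = 1%N%:E \/ diam (B G) = +oo%E)) /\
  matching_number_eq (B G) (L2 G) /\
  clique_number_eq (B G) `I_2.
Proof.
split; first by split; [exact: girth_B | exact: diam_B].
by split; [exact: matching_B | exact: clique_B].
Qed.
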